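(* Let $A$ be a bi-quadratic algebra on 3 generators over a field $K$ with parameters $q_1,q_2,q_3\in K^\times$. Suppose that all $q_i\ne 1$, $q_1-q_3\ne 0$, $1-q_1q_2\ne 0$ and $1-q_2q_3=0$. Then (up to $G_3'$): $$x_2x_1=q_1x_1x_2+cx_3+b_1,\quad x_3x_1=q_2x_1x_3,\quad x_3x_2=q_2^{-1}x_2x_3$$ where $c,b_1\in\{0,1\}$.
   Context: Let $K$ be a field, $K^\times=K\setminus\{0\}$. A bi-quadratic algebra on 3 generators is a $K$-algebra $A$ generated by $x_1,x_2,x_3$ subject to the defining relations $x_2x_1-q_1x_1x_2=ax_1+bx_2+cx_3+b_1$, $x_3x_1-q_2x_1x_3=\alpha x_1+\beta x_2+\gamma x_3+b_2$, $x_3x_2-q_3x_2x_3=\lambda x_1+\mu x_2+\nu x_3+b_3$, where $q_1,q_2,q_3\in K^\times$ and the other coefficients are in $K$, such that the monomials $x_1^ix_2^jx_3^k$ ($i,j,k\ge0$) form a $K$-basis of $A$ (PBW basis). $G_3'$ is the group of changes of generators generated by the affine changes $x_i\mapsto\lambda_ix_i+\mu_i$ ($\lambda_i\in K^\times$, $\mu_i\in K$) and the permutations $x_i\mapsto x_{\sigma(i)}$, $\sigma\in S_3$. ''Up to $G_3'$'' means: after such a change of canonical generators the new canonical generators (again denoted $x_1,x_2,x_3$) have the displayed defining relations (with new parameters denoted by the same letters). *)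

(* Defs.v *)
From HB Require Import structures.
From mathcomp Require Import all_boot all_order all_algebra all_fingroup.
From mathcomp Require Import finmap monalg.

Set Implicit Arguments.
Unset Strict Implicit.
Unset Printing Implicit Defensive.

Import GRing.Theory.
Local Open Scope ring_scope.

Definition i1 : 'I_3 := @Ordinal 3 0 isT.
Definition i2 : 'I_3 := @Ordinal 3 1 isT.
Definition i3 : 'I_3 := @Ordinal 3 2 isT.

(* The free algebra K<X_1, X_2, X_3>: the monoid algebra of the free monoid. *)
Notation freealg K := {malg K[{fmonom 'I_3}]}.

Definition fgen (K : fieldType) (i : 'I_3) : freealg K := << fmu i >>.

Definition feval (K : fieldType) (A : algType K) (x : 'I_3 -> A)
    (p : freealg K) : A :=
  \sum_(m <- msupp p) p@_m *: \prod_(i <- (m : seq 'I_3)) x i.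

Definition two_sided_ideal (R : nzRingType) (rs : seq R) (p : R) : Prop :=
  exists s : seq (R * R * R),
    (forall t, t \in s -> t.1.2 \in rs)
    /\ p = \sum_(t <- s) t.1.1 * t.1.2 * t.2.

(* [x] generates [A], and [rs] are defining relations between the [x i],
   i.e. A = K<X_1, X_2, X_3> / (rs) with [x i] the image of X_i. *)
Definition presented_by (K : fieldType) (A : algType K) (x : 'I_3 -> A)
    (rs : seq (freealg K)) : Prop :=
  (forall a : A, exists p : freealg K, feval x p = a)
  /\ (forall p : freealg K, feval x p = 0 <-> two_sided_ideal rs p).

Definition is_basis (K : fieldType) (A : lmodType K) (I : eqType) (e : I -> A)
    : Prop :=
  (forall (s : seq I) (c : I -> K), uniq s ->
     \sum_(i <- s) c i *: e i = 0 -> forall i, i \in s -> c i = 0)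
  /\ (forall a : A, exists (s : seq I) (c : I -> K),
        a = \sum_(i <- s) c i *: e i).

Definition pbw_monomial (K : fieldType) (A : algType K) (x : 'I_3 -> A)
    (m : nat * nat * nat) : A :=
  x i1 ^+ m.1.1 * x i2 ^+ m.1.2 * x i3 ^+ m.2.

(* For l = (a, b, c, d), the element
   X_j X_i - q X_i X_j - (a X_1 + b X_2 + c X_3 + d). *)
Definition bq_relator (K : fieldType) (j i : 'I_3) (q : K)
    (l : K * K * K * K) : freealg K :=
  let: (a, b, c, d) := l in
  fgen K j * fgen K i - q *: (fgen K i * fgen K j)
  - (a *: fgen K i1 + b *: fgen K i2 + c *: fgen K i3 + d%:A).

(* [A] is a bi-quadratic algebra with canonical generators x_1, x_2, x_3,
   relations
     x_2 x_1 - q_1 x_1 x_2 = l21,   l21 = (a, b, c, b_1),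
     x_3 x_1 - q_2 x_1 x_3 = l31,   l31 = (alpha, beta, gamma, b_2),
     x_3 x_2 - q_3 x_2 x_3 = l32,   l32 = (lambda, mu, nu, b_3),
   and PBW basis x_1^i x_2^j x_3^k. *)
Definition biquadratic (K : fieldType) (A : algType K) (x : 'I_3 -> A)
    (q : K * K * K) (l21 l31 l32 : K * K * K * K) : Prop :=
  let: (q1, q2, q3) := q in
  [/\ [/\ q1 != 0, q2 != 0 & q3 != 0],
      presented_by x [:: bq_relator i2 i1 q1 l21;
                         bq_relator i3 i1 q2 l31;
                         bq_relator i3 i2 q3 l32]
    & is_basis (pbw_monomial x)].

(* [G3' x y]: the triple [y] is obtained from [x] by an element of the group
   G_3'. No constructor for inverses is needed, since the inverse of an affine
   change (resp. of a permutation) is again one. *)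
Inductive G3' (K : fieldType) (A : algType K) (x : 'I_3 -> A)
    : ('I_3 -> A) -> Prop :=
| G3'_id : G3' x x
| G3'_affine (y : 'I_3 -> A) (l m : 'I_3 -> K) :
    G3' x y -> (forall i, l i != 0) ->
    G3' x (fun i => l i *: y i + (m i)%:A)
| G3'_perm (y : 'I_3 -> A) (s : 'S_3) :
    G3' x y -> G3' x (fun i => y (s i)).

(* Main.v *)
(* Reducing x3 x2 x1 to the PBW basis in two ways and comparing coefficients
   constrains the parameters. Translating x1, x2, x3 kills b, a, alpha
   respectively (possible since q1, q2 != 1); the comparison then forces all
   parameters but c and b1 to vanish, the coefficient of x3^2 being harmless
   because q2 q3 = 1. Rescaling x1 and x3 normalizes b1 and c.
   An affine change preserves the PBW property because ordered monomials expand
   triangularly, without commuting generators, and preserves the presentation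
   because it lifts to an automorphism of the free algebra matching the
   relators up to nonzero scalars. *)

Require Import Defs.
From HB Require Import structures.
From mathcomp Require Import all_boot all_order all_algebra all_fingroup.
From mathcomp Require Import finmap monalg ring zify.

Set Implicit Arguments.
Unset Strict Implicit.
Unset Printing Implicit Defensive.

Import GRing.Theory.
Local Open Scope ring_scope.

(** * Relations evaluated in an arbitrary algebra *)

Definition bq_defect (K : fieldType) (B : algType K) (z : 'I_3 -> B)
    (j i : 'I_3) (q : K) (l : K * K * K * K) : B :=
  let: (a, b, c, d) := l in
  z j * z i - q *: (z i * z j)
  - (a *: z i1 + b *: z i2 + c *: z i3 + d%:A).

Lemma eq_bq_defect (K : fieldType) (B : algType K) (z w : 'I_3 -> B) j i q l :
  z =1 w -> bq_defect z j i q l = bq_defect w j i q l.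
Proof. by move=> zw; rewrite /bq_defect !zw. Qed.

(** Since the defect makes sense in every algebra, one computation serves both in [A] and in the
    free algebra; homomorphisms carry the result from one to the other. *)
Lemma bq_defect_morph (K : fieldType) (B C : algType K)
    (f : {lrmorphism B -> C}) (z : 'I_3 -> B) j i q l :
  f (bq_defect z j i q l) = bq_defect (f \o z) j i q l.
Proof.
case: l => [[[a b] c] d] /=.
have fZ k u : f (k *: u) = k *: f u by exact: linearZ.
have fM u v : f (u * v) = f u * f v by exact: rmorphM.
have fB u v : f (u - v) = f u - f v by exact: raddfB.
have fD u v : f (u + v) = f u + f v by exact: raddfD.
by rewrite !fB !fD !fZ !fM rmorph1.
Qed.

(** * The free algebra and its evaluation homomorphisms *)

Section FreeAlgebra.
Context (K : fieldType).

(* [{malg K[M]}] is canonically an algebra only for commutative monoids [M],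
   so the algebra structure is put on an alias. *)
Definition free_algebra : predArgType := freealg K.

HB.instance Definition _ := GRing.Lalgebra.copy free_algebra (freealg K).

(** Constants are central: as [K] is commutative, multiplying by [k%:MP] on either side is scaling
    by [k]. *)
Fact free_algebra_scaleAr (k : K) (p r : free_algebra) :
  k *: (p * r) = p * (k *: r).
Proof.
have scale_malgC (s : freealg K) : k *: s = s * k%:MP.
  rewrite malgM_def fgmulgU malgZ_def; apply: eq_bigr => m _.
  by rewrite mulm1 mulrC.
have mulC (s : freealg K) : k%:MP * s = k *: s := mul_malgC k s.
have mulA (s t u : freealg K) : s * (t * u) = s * t * u := mulrA s t u.
transitivity ((p : freealg K) * (k%:MP * (r : freealg K))).
  by rewrite mulA -scale_malgC; apply: scalerAl.
by rewrite mulC.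
Qed.

HB.instance Definition _ :=
  GRing.Lalgebra_isAlgebra.Build K free_algebra free_algebra_scaleAr.

Definition free_gen : 'I_3 -> free_algebra := @fgen K.

Section Evaluation.
Context (A : algType K) (x : 'I_3 -> A).

Let word (m : {fmonom 'I_3}) : A := \prod_(i <- (m : seq 'I_3)) x i.

Fact word_mmorphism : mmorphism word.
Proof.
split=> [m n|]; rewrite /word; first by rewrite fmM big_cat.
by rewrite fm1 big_nil.
Qed.

HB.instance Definition _ := monalg.isMultiplicative.Build _ A word word_mmorphism.

Definition feval_hom (p : free_algebra) : A := feval x p.

Lemma feval_mmap p : feval_hom p = mmap (in_alg A) word p.
Proof. by apply: eq_bigr => m _; rewrite mulr_algl. Qed.

Fact feval_is_additive : additive feval_hom.
Proof. by move=> p r; rewrite !feval_mmap raddfB. Qed.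

(** [A] need not be commutative: it suffices that the images of the coefficients, being scalars,
    commute with the images of words. *)
Fact feval_is_multiplicative : multiplicative feval_hom.
Proof.
have [|feM fe1] := @commr_mmap_is_multiplicative _ _ _ (in_alg A) word.
  by move=> p m n; rewrite /GRing.comm mulr_algl mulr_algr.
by split=> [p r|]; rewrite !feval_mmap; [apply: feM|apply: fe1].
Qed.

Fact feval_is_scalable : scalable feval_hom.
Proof. by move=> k p; rewrite !feval_mmap mmapZ mulr_algl. Qed.

HB.instance Definition _ :=
  GRing.isAdditive.Build free_algebra A feval_hom feval_is_additive.
HB.instance Definition _ :=
  GRing.isMultiplicative.Build free_algebra A feval_hom feval_is_multiplicative.
HB.instance Definition _ :=
  GRing.isScalable.Build K free_algebra A *:%R feval_hom feval_is_scalable.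

Lemma feval_gen i : feval x (fgen K i) = x i.
Proof.
rewrite -[LHS]/(feval_hom _) feval_mmap /fgen mmapU mulr_algl scale1r.
by rewrite /word fmU big_seq1.
Qed.

Lemma feval_relator j i q l :
  feval x (bq_relator j i q l) = bq_defect x j i q l.
Proof.
(* A relator is, by conversion, the defect of the free generators. *)
transitivity (feval_hom (bq_defect free_gen j i q l)); first by [].
by rewrite bq_defect_morph; apply: eq_bq_defect; apply: feval_gen.
Qed.

End Evaluation.

Lemma eq_feval (A : algType K) (x y : 'I_3 -> A) : x =1 y -> feval x =1 feval y.
Proof.
by move=> xy p; apply: eq_bigr => m _; congr (_ *: _); apply: eq_bigr.
Qed.

Lemma feval_comp (A B : algType K) (f : {lrmorphism A -> B}) (x : 'I_3 -> A) p :
  f (feval x p) = feval (f \o x) p.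
Proof.
by rewrite linear_sum; apply: eq_bigr => m _; rewrite linearZ /= rmorph_prod.
Qed.

(** This lets mutually inverse substitutions of the generators cancel on every element of the free
    algebra. The proof is by induction on words. *)
Lemma feval_fgen p : feval free_gen p = p.
Proof.
have scaleU (c : K) m : c *: << m >> = << c *g m >> :> freealg K.
  by rewrite -mul_malgC malgM_def fgmulUU mulr1 mul1m.
rewrite [RHS]monalgE; apply: eq_bigr => m _; rewrite -scaleU; congr (_ *: _).
case: m => s; elim: s => [|i s IHs] /=; rewrite ?big_nil ?big_cons.
  by rewrite -fmoneE.
rewrite /= in IHs; rewrite IHs.
transitivity (<< fmu i >> * << FMonom s >> : freealg K); first by [].
rewrite malgM_def fgmulUU mulr1; congr << _ >>.
by apply/eqP; rewrite -val_eqE /= fmM fmU.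
Qed.

Lemma feval_feval (A : algType K) (y : 'I_3 -> A)
    (x : 'I_3 -> free_algebra) p :
  feval y (feval x p) = feval (fun i => feval y (x i)) p.
Proof. exact: (feval_comp (feval_hom y)). Qed.

End FreeAlgebra.

(** * Two-sided ideals and homomorphisms *)

Lemma ideal_generator (R : nzRingType) (rs : seq R) (r : R) :
  r \in rs -> two_sided_ideal rs r.
Proof.
move=> rsr; exists [:: (1, r, 1)]; split=> [t|]; last first.
  by rewrite big_seq1 mul1r mulr1.
by rewrite inE => /eqP->.
Qed.

Lemma ideal_mul (R : nzRingType) (rs : seq R) (u v p : R) :
  two_sided_ideal rs p -> two_sided_ideal rs (u * p * v).
Proof.
move=> [s [s_rs ->]]; exists [seq (u * t.1.1, t.1.2, t.2 * v) | t <- s].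
split=> [t /mapP[t' /s_rs rst' ->]//|].
rewrite big_map mulr_sumr mulr_suml; apply: eq_bigr => t _ /=.
by rewrite !mulrA.
Qed.

Lemma ideal_sum (R : nzRingType) (rs : seq R) (I : eqType) (s : seq I)
    (F : I -> R) :
  (forall i, i \in s -> two_sided_ideal rs (F i)) ->
  two_sided_ideal rs (\sum_(i <- s) F i).
Proof.
elim: s => [|i s IHs] Fs; first by exists [::]; rewrite !big_nil.
have [|s1 [rs1 E1]] := IHs; first by move=> j js; apply: Fs; rewrite inE js orbT.
have [|s2 [rs2 E2]] := Fs i; first by rewrite mem_head.
exists (s2 ++ s1); split; last by rewrite big_cons big_cat E1 E2.
by move=> t; rewrite mem_cat => /orP[/rs2|/rs1].
Qed.

Lemma ideal_image (R S : nzRingType) (f : {rmorphism R -> S}) rs rs' p :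
  (forall r, r \in rs -> two_sided_ideal rs' (f r)) ->
  two_sided_ideal rs p -> two_sided_ideal rs' (f p).
Proof.
move=> rs_rs' [s [s_rs ->]]; rewrite rmorph_sum; apply: ideal_sum => t ts.
by rewrite !rmorphM; apply/ideal_mul/rs_rs'/s_rs.
Qed.

Lemma ideal_kernel (R S : nzRingType) (f : {rmorphism R -> S}) rs p :
  (forall r, r \in rs -> f r = 0) -> two_sided_ideal rs p -> f p = 0.
Proof.
move=> rs0 [s [s_rs ->]]; rewrite rmorph_sum big_seq big1 // => t /s_rs/rs0 t0.
by rewrite !rmorphM /= t0 mulr0 mul0r.
Qed.

(** * Affine changes of generators and presentations *)

Section AffineChange.
Context (K : fieldType).
Implicit Types (l m : 'I_3 -> K).

Definition affine (A : algType K) l m (x : 'I_3 -> A) (i : 'I_3) : A :=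
  l i *: x i + (m i)%:A.

(** Solving [y = l x + m] for [x] is again an affine change, so every fact about [affine] applies to
    the inverse too. *)
Definition affine_inv (A : algType K) l m : ('I_3 -> A) -> 'I_3 -> A :=
  affine (fun i => (l i)^-1) (fun i => - (m i / l i)).

Lemma affineK (A : algType K) l m (x : 'I_3 -> A) :
  (forall i, l i != 0) -> affine_inv l m (affine l m x) =1 x.
Proof.
move=> l0 i; rewrite /affine_inv /affine scalerDr !scalerA mulVf // scale1r.
by rewrite -addrA -scalerDl mulrC subrr scale0r addr0.
Qed.

Lemma affine_invK (A : algType K) l m (x : 'I_3 -> A) :
  (forall i, l i != 0) -> affine l m (affine_inv l m x) =1 x.
Proof.
move=> l0 i; rewrite /affine_inv /affine scalerDr !scalerA mulfV // scale1r.
by rewrite -addrA -scalerDl mulrN mulrCA mulfV // mulr1 addNr scale0r addr0.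
Qed.

Lemma affine_morph (A B : algType K) (f : {lrmorphism A -> B}) l m
    (x : 'I_3 -> A) : f \o affine l m x =1 affine l m (f \o x).
Proof. by move=> i; rewrite /affine /= rmorphD /= !linearZ /= rmorph1. Qed.

Lemma eq_affine (A : algType K) l m (x y : 'I_3 -> A) :
  x =1 y -> affine l m x =1 affine l m y.
Proof. by move=> xy i; rewrite /affine xy. Qed.

Lemma feval_affine (A : algType K) (x : 'I_3 -> A) l m i :
  feval x (affine l m (@free_gen K) i) = affine l m x i.
Proof.
rewrite -[LHS]/((feval_hom x \o affine l m (@free_gen K)) i) affine_morph.
by apply: eq_affine => j; apply: feval_gen.
Qed.

(** Let [S] be the substitution of the free algebra given by [l] and [m]. If [p] vanishes at the new
    generators, then [S p] vanishes at the old ones, hence lies in the ideal of [rs]; the inverse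
    substitution sends that ideal into the ideal of [rs'] and [S p] back to [p]. *)
Lemma presented_by_affine (A : algType K) (x : 'I_3 -> A) l m rs rs' :
  (forall i, l i != 0) ->
  (forall r, r \in rs' -> feval (affine l m x) r = 0) ->
  (forall r, r \in rs ->
     two_sided_ideal rs' (feval (affine_inv l m (@free_gen K)) r)) ->
  presented_by x rs -> presented_by (affine l m x) rs'.
Proof.
move=> l0 rs'0 rs_rs' [x_gen x_rel]; split=> [a|p].
  have [p <-] := x_gen a; exists (feval (affine_inv l m (@free_gen K)) p).
  rewrite feval_feval; apply: eq_feval => i.
  by rewrite feval_affine -/(affine_inv _ _ _) affineK.
split=> [yp0|]; last exact: (@ideal_kernel _ _ (feval_hom _)).
have Ep : feval (affine_inv l m (@free_gen K))
                (feval (affine l m (@free_gen K)) p) = p.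
  rewrite feval_feval -[RHS]feval_fgen; apply: eq_feval => i.
  by rewrite feval_affine affine_invK.
rewrite -Ep; apply: (@ideal_image (free_algebra K) (free_algebra K)
          (feval_hom (affine_inv l m (@free_gen K))) _ _ _ rs_rs').
apply/x_rel; rewrite feval_feval -yp0.
by apply: eq_feval => i; rewrite feval_affine.
Qed.

End AffineChange.

(** * PBW monomials under affine changes *)

Lemma exists_max_seq (T : eqType) (f : T -> nat) (s : seq T) :
  s != [::] -> exists2 v, v \in s & forall t, t \in s -> (f t <= f v)%N.
Proof.
elim: s => // w s IHs _; have [->|/IHs[v vs v_max]] := eqVneq s [::].
  by exists w => [|t]; rewrite inE // => /eqP->.
have [wv|vw] := leqP (f w) (f v).
  by exists v => [|t]; rewrite inE ?vs ?orbT // => /orP[/eqP->|/v_max].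
exists w => [|t]; rewrite inE ?eqxx // => /orP[/eqP->//|/v_max] tv.
exact: leq_trans tv (ltnW vw).
Qed.

Section Monomials.
Context (K : fieldType).
Implicit Types (s t : nat * nat * nat).

(** Boxes are finite and closed downwards for the componentwise order, so the expansion of a new
    monomial with exponents in a box stays in that box. *)
Definition box (N : nat) : seq (nat * nat * nat) :=
  [seq (ij, k) | ij <- [seq (i, j) | i <- iota 0 N, j <- iota 0 N],
                 k <- iota 0 N].

Lemma mem_box N t : (t \in box N) = [&& t.1.1 < N, t.1.2 < N & t.2 < N]%N.
Proof.
case: t => [[i j] k] /=; apply/allpairsP/and3P.
  move=> [[[i' j'] k'] /= [/allpairsP[[i'' j''] /= []]]].
  by rewrite !mem_iota /= !add0n => ? ? [-> ->] ? [-> -> ->].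
move=> [iN jN kN]; exists ((i, j), k); split; rewrite ?mem_iota //=.
by apply/allpairsP; exists (i, j); rewrite !mem_iota.
Qed.

Lemma box_uniq N : uniq (box N).
Proof.
by do 2![apply: allpairs_uniq; rewrite ?iota_uniq //; last by case=> ? ? []].
Qed.

Lemma big_box (V : nmodType) N (F : nat -> nat -> nat -> V) :
  \sum_(t <- box N) F t.1.1 t.1.2 t.2 =
  \sum_(i < N) \sum_(j < N) \sum_(k < N) F i j k.
Proof.
rewrite big_allpairs /= big_allpairs /=.
rewrite -[in LHS](subn0 N) big_mkord; apply: eq_bigr => i _.
rewrite big_mkord; apply: eq_bigr => j _.
by rewrite big_mkord.
Qed.

Lemma subset_box (s : seq (nat * nat * nat)) :
  exists N, {subset s <= box N}.
Proof.
elim: s => [|t s [N sN]]; first by exists 0%N.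
exists (maxn N (maxn t.1.1 (maxn t.1.2 t.2)).+1) => u.
rewrite inE => /orP[/eqP->|/sN].
  by rewrite mem_box !leq_max !ltnS !leq_max !leqnn !orbT.
by rewrite !mem_box !leq_max => /and3P[-> -> ->].
Qed.

(** Each factor is a coefficient of a univariate power [(l X + m)^n]: the three generators are
    expanded separately, so they never have to commute. *)
Definition affine_coef (l m : 'I_3 -> K) s t : K :=
  let c i n k := ((l i *: 'X + (m i)%:P) ^+ n)`_k in
  c i1 s.1.1 t.1.1 * c i2 s.1.2 t.1.2 * c i3 s.2 t.2.

Lemma size_affineX (l m : K) n :
  l != 0 -> size ((l *: 'X + m%:P) ^+ n) = n.+1.
Proof.
move=> l0; have sz : size (l *: 'X + m%:P) = 2%N.
  by rewrite size_polyDl size_scale ?size_polyX // size_polyC; case: eqP.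
rewrite -[LHS]prednK ?size_exp ?sz ?mul1n // lt0n size_poly_eq0 expf_neq0 //.
by rewrite -size_poly_eq0 sz.
Qed.

Lemma coef_affineX (l m : K) n k :
  l != 0 -> ((l *: 'X + m%:P) ^+ n)`_k != 0 -> (k <= n)%N.
Proof.
move=> l0; rewrite -ltnS -(size_affineX m n l0) ltnNge; apply: contraNN.
by move=> ?; apply/eqP/nth_default.
Qed.

Lemma lead_affineX (l m : K) n :
  l != 0 -> ((l *: 'X + m%:P) ^+ n)`_n = l ^+ n.
Proof.
move=> l0; have := lead_coefE ((l *: 'X + m%:P) ^+ n).
rewrite size_affineX //= => <-; rewrite lead_coef_exp lead_coefDl.
  by rewrite lead_coefZ lead_coefX mulr1.
by rewrite size_scale // size_polyX size_polyC; case: eqP.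
Qed.

Lemma affine_coef_neq0 l m s t : (forall i, l i != 0) ->
  affine_coef l m s t != 0 ->
  [&& t.1.1 <= s.1.1, t.1.2 <= s.1.2 & t.2 <= s.2]%N.
Proof.
move=> l0; rewrite /affine_coef !mulf_eq0 !negb_or -andbA.
by move=> /and3P[c1 c2 c3]; rewrite (coef_affineX (l0 _) c1)
  (coef_affineX (l0 _) c2) (coef_affineX (l0 _) c3).
Qed.

Lemma affine_coef_diag l m s : (forall i, l i != 0) -> affine_coef l m s s != 0.
Proof.
by move=> l0; rewrite /affine_coef !lead_affineX // !mulf_neq0 ?expf_neq0.
Qed.

Context (A : algType K).
Implicit Type x : 'I_3 -> A.

(** Powers of a single generator live in the image of [K[X]] under [X -> x i], where the polynomial
    expansion applies. The common bound [N] gives all three exponents the same range of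
    summation. *)
Lemma affineX x l m i n N : (forall i, l i != 0) -> (n < N)%N ->
  affine l m x i ^+ n =
  \sum_(k < N) ((l i *: 'X + (m i)%:P) ^+ n)`_k *: x i ^+ k.
Proof.
move=> l0 nN.
transitivity (horner_alg (x i) ((l i *: 'X + (m i)%:P) ^+ n)).
  rewrite -mul_polyC rmorphXn rmorphD rmorphM /= horner_algX !horner_algC.
  by rewrite mulr_algl.
rewrite /horner_alg /horner_morph.
rewrite (@horner_coef_wide _ N); last first.
  by rewrite (leq_trans (size_poly _ _)) // size_affineX.
by apply: eq_bigr => k _; rewrite coef_map /= mulr_algl.
Qed.

Lemma pbw_affine x l m s N : (forall i, l i != 0) -> s \in box N ->
  pbw_monomial (affine l m x) s =
  \sum_(t <- box N) affine_coef l m s t *: pbw_monomial x t.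
Proof.
move=> l0; rewrite mem_box => /and3P[s1 s2 s3].
rewrite (@big_box _ N (fun i j k => affine_coef l m s (i, j, k) *:
                                    pbw_monomial x (i, j, k))).
rewrite /pbw_monomial (affineX _ _ _ l0 s1) (affineX _ _ _ l0 s2).
rewrite (affineX _ _ _ l0 s3).
rewrite !mulr_suml; apply: eq_bigr => i _.
rewrite -mulrA mulr_suml mulr_sumr; apply: eq_bigr => j _.
rewrite mulrA mulr_sumr; apply: eq_bigr => k _.
by rewrite -!(scalerAl, scalerAr) !scalerA /affine_coef /=; congr (_ *: _);
   ring.
Qed.

Lemma basis_box_eq0 x N (c : nat * nat * nat -> K) :
  is_basis (pbw_monomial x) ->
  \sum_(t <- box N) c t *: pbw_monomial x t = 0 ->
  forall t, t \in box N -> c t = 0.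
Proof. by move=> [free _]; apply: free (box_uniq N). Qed.

Lemma pbw_affine_sum x l m (s : seq (nat * nat * nat))
    (c : nat * nat * nat -> K) N :
  (forall i, l i != 0) -> {subset s <= box N} ->
  \sum_(i <- s) c i *: pbw_monomial (affine l m x) i =
  \sum_(t <- box N)
    (\sum_(i <- s) c i * affine_coef l m i t) *: pbw_monomial x t.
Proof.
move=> l0 sN; under [RHS]eq_bigr do rewrite scaler_suml.
rewrite exchange_big /=; apply: eq_big_seq => i /sN iN.
rewrite (pbw_affine _ _ l0 iN) scaler_sumr.
by apply: eq_bigr => t _; rewrite scalerA.
Qed.

(* The expansion of the new monomials in the old ones is triangular for the
   componentwise order on exponents, with nonzero diagonal coefficients. *)
Lemma is_basis_affine x l m : (forall i, l i != 0) ->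
  is_basis (pbw_monomial x) -> is_basis (pbw_monomial (affine l m x)).
Proof.
move=> l0 basis_x; split=> [s c s_uniq|a]; last first.
  have [_ /(_ a)[s [c ->]]] := basis_x; have [N sN] := subset_box s.
  (* Spanning: the old monomials are expanded in the new ones through the inverse change. *)
  exists (box N), (fun t => \sum_(i <- s) c i *
    affine_coef (fun i => (l i)^-1) (fun i => - (m i / l i)) i t).
  rewrite -(pbw_affine_sum _ _ _ _ sN); last by move=> i; rewrite invr_eq0.
  apply: eq_bigr => t _; congr (_ *: _).
  by rewrite /pbw_monomial -!(affineK m x l0).
have [N sN] := subset_box s; rewrite (pbw_affine_sum _ _ _ l0 sN).
move/(basis_box_eq0 basis_x) => coef0 u us; apply/eqP/negP => /negP cu.
pose deg t := (t.1.1 + t.1.2 + t.2)%N.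
pose supp := [seq t <- s | c t != 0].
(* Independence: among the monomials with nonzero coefficient, [v] has maximal total degree; the old
   monomial with exponents [v] is examined. *)
have [|v v_supp v_max] := @exists_max_seq _ deg supp.
  apply/eqP => s0; have := mem_filter (fun t => c t != 0) u s.
  by rewrite -/supp s0 cu us.
move: v_supp; rewrite mem_filter => /andP[cv vs].
have := coef0 v (sN v vs); rewrite (bigD1_seq v) //= big_seq_cond big1 => [|t].
  move/eqP; rewrite addr0 mulf_eq0 (negPf cv).
  by rewrite (negPf (affine_coef_diag _ _ l0)).
(* A contribution from another [t] would need [v <= t] componentwise, and maximality of the degree
   of [v] would then give [t = v]. *)
case/andP=> ts tv; apply/eqP; rewrite mulf_eq0 -[_ || _]negbK negb_or.
apply/negP => /andP[ct /(affine_coef_neq0 l0) /and3P[le1 le2 le3]].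
have /v_max : t \in supp by rewrite mem_filter ct.
rewrite /deg => le_deg; case/negP: tv; apply/eqP.
case: t v le1 le2 le3 le_deg {ct ts cv vs v_max} => [[t1 t2] t3] [[v1 v2] v3] /=.
by move=> *; congr (_, _, _); lia.
Qed.

End Monomials.

(** * Identities between linear combinations, by coefficients *)

Section LinearCombinations.
Context (K : fieldType) (V : lmodType K) (e : seq V).
Implicit Types (c d : nat -> K) (u v : V).

Definition is_lc c u := u = \sum_(k < size e) c k *: e`_k.

Lemma lc_atom k : (k < size e)%N -> is_lc (fun i => (i == k)%:R) e`_k.
Proof.
move=> ke; rewrite /is_lc (bigD1 (Ordinal ke)) //= eqxx scale1r big1 ?addr0 //.
by move=> i; rewrite -val_eqE /= => /negPf->; rewrite scale0r.
Qed.

Lemma lcD c d u v :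
  is_lc c u -> is_lc d v -> is_lc (fun i => c i + d i) (u + v).
Proof.
move=> -> ->; rewrite /is_lc -big_split.
by apply: eq_bigr => k _; rewrite scalerDl.
Qed.

Lemma lcZ c u k : is_lc c u -> is_lc (fun i => k * c i) (k *: u).
Proof.
move=> ->; rewrite /is_lc scaler_sumr.
by apply: eq_bigr => i _; rewrite scalerA.
Qed.

Lemma lcN c u : is_lc c u -> is_lc (fun i => - c i) (- u).
Proof.
by move=> ->; rewrite /is_lc -sumrN; apply: eq_bigr => i _; rewrite scaleNr.
Qed.

Lemma lc_eq c d u v : is_lc c u -> is_lc d v ->
  all (fun k => c k == d k) (iota 0 (size e)) -> u = v.
Proof.
move=> -> -> /allP cd; apply: eq_bigr => k _; congr (_ *: _).
by apply/eqP/cd; rewrite mem_iota /=.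
Qed.

End LinearCombinations.

(** Reification: the unknown coefficient function is built by unification while the expression is
    traversed. Eleven atoms cover the monomials met in the overlap. *)
Ltac lc_rec :=
  first
  [ apply: lcD; lc_rec | apply: lcN; lc_rec
  | apply: lcZ; lc_rec
  | exact: (@lc_atom _ _ _ 0) | exact: (@lc_atom _ _ _ 1)
  | exact: (@lc_atom _ _ _ 2) | exact: (@lc_atom _ _ _ 3)
  | exact: (@lc_atom _ _ _ 4) | exact: (@lc_atom _ _ _ 5)
  | exact: (@lc_atom _ _ _ 6) | exact: (@lc_atom _ _ _ 7)
  | exact: (@lc_atom _ _ _ 8) | exact: (@lc_atom _ _ _ 9)
  | exact: (@lc_atom _ _ _ 10) ].

(** Equal coefficients on the listed atoms suffice for equality, whether or not the atoms are
    independent; [ring] compares them in [K]. *)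
Ltac module e :=
  apply: (@lc_eq _ _ e); [lc_rec | lc_rec |];
  rewrite /=; repeat (apply/andP; split); try (by []); apply/eqP; ring.

Lemma forall_mem3 (T : eqType) (P : T -> Prop) a b c :
  P a -> P b -> P c -> forall r, r \in [:: a; b; c] -> P r.
Proof. by move=> Pa Pb Pc r; rewrite !inE => /or3P[] /eqP->. Qed.

Lemma mem_seq3 (T : eqType) (a b c : T) :
  [/\ a \in [:: a; b; c], b \in [:: a; b; c] & c \in [:: a; b; c]].
Proof. by rewrite !inE !eqxx !orbT. Qed.

(** * Transformation of the relations under affine changes *)

Section AffineRelations.
Context (K : fieldType).
Implicit Types (l m : 'I_3 -> K) (L : K * K * K * K).

(** The quantification over [B] makes the identity available in [A], where it shows that the new
    relations hold, and in the free algebra, where it compares ideals. *)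
Definition affine_rel l m (j i : 'I_3) (q : K) L L' : Prop :=
  forall (B : algType K) (z : 'I_3 -> B),
    bq_defect (affine l m z) j i q L' = (l j * l i) *: bq_defect z j i q L.

Ltac affine_rel_tac :=
  move=> B z; rewrite /bq_defect /affine !(mulrDl, mulrDr);
  rewrite -!(scalerAl, scalerAr);
  rewrite !(mulr1, mul1r).

(** Expanding the shifted product adds to the coefficient of each of the two generators [1 - q]
    times the shift of the other one; for [q != 1] these coefficients can thus be given any
    value. *)
Lemma shift_rel21 m q a b c d :
  affine_rel (fun=> 1) m i2 i1 q (a, b, c, d)
    (a + (1 - q) * m i2, b + (1 - q) * m i1, c,
     d - a * m i1 - b * m i2 - c * m i3 - (1 - q) * m i1 * m i2).
Proof.
affine_rel_tac; module [:: z i2 * z i1; z i1 * z i2; z i1; z i2; z i3; 1].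
Qed.

Lemma shift_rel31 m q a b c d :
  affine_rel (fun=> 1) m i3 i1 q (a, b, c, d)
    (a + (1 - q) * m i3, b, c + (1 - q) * m i1,
     d - a * m i1 - b * m i2 - c * m i3 - (1 - q) * m i1 * m i3).
Proof.
affine_rel_tac; module [:: z i3 * z i1; z i1 * z i3; z i1; z i2; z i3; 1].
Qed.

Lemma shift_rel32 m q a b c d :
  affine_rel (fun=> 1) m i3 i2 q (a, b, c, d)
    (a, b + (1 - q) * m i3, c + (1 - q) * m i2,
     d - a * m i1 - b * m i2 - c * m i3 - (1 - q) * m i2 * m i3).
Proof.
affine_rel_tac; module [:: z i3 * z i2; z i2 * z i3; z i1; z i2; z i3; 1].
Qed.

Lemma scale_rel l j i q a b c d a' b' c' d' :
  a' * l i1 = l j * l i * a -> b' * l i2 = l j * l i * b ->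
  c' * l i3 = l j * l i * c -> d' = l j * l i * d ->
  affine_rel l (fun=> 0) j i q (a, b, c, d) (a', b', c', d').
Proof.
move=> Ea Eb Ec Ed B z; rewrite /bq_defect /affine !scale0r !addr0.
rewrite -!(scalerAl, scalerAr) !scalerA Ea Eb Ec Ed.
module [:: z j * z i; z i * z j; z i1; z i2; z i3; 1].
Qed.

Lemma affine_rel_inv l m j i q L L' (B : algType K) (z : 'I_3 -> B) :
  (forall k, l k != 0) -> affine_rel l m j i q L L' ->
  bq_defect (affine_inv l m z) j i q L = (l j * l i)^-1 *: bq_defect z j i q L'.
Proof.
move=> l0 rel; rewrite -(eq_bq_defect _ _ _ _ (affine_invK m z l0)) rel.
by rewrite scalerA mulVf ?mulf_neq0 // scale1r.
Qed.

Lemma ideal_scale (B : algType K) (rs : seq B) (k : K) r :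
  r \in rs -> two_sided_ideal rs (k *: r).
Proof.
move=> rsr; have -> : k *: r = k%:A * r * 1 by rewrite mulr1 mulr_algl.
exact/ideal_mul/ideal_generator.
Qed.

(** The inverse substitution turns the old relator into a nonzero scalar multiple of the new one. *)
Lemma affine_rel_ideal l m j i q L L' rs : (forall k, l k != 0) ->
  affine_rel l m j i q L L' -> bq_relator j i q L' \in rs ->
  two_sided_ideal rs (feval (affine_inv l m (@free_gen K)) (bq_relator j i q L)).
Proof.
move=> l0 rel rs_L'; rewrite feval_relator (affine_rel_inv _ l0 rel).
exact: (@ideal_scale (free_algebra K)).
Qed.

Lemma biquadratic_relations (A : algType K) (x : 'I_3 -> A) q1 q2 q3
    L21 L31 L32 : biquadratic x (q1, q2, q3) L21 L31 L32 ->
  [/\ bq_defect x i2 i1 q1 L21 = 0, bq_defect x i3 i1 q2 L31 = 0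
    & bq_defect x i3 i2 q3 L32 = 0].
Proof.
have [m21 m31 m32] := mem_seq3 (bq_relator i2 i1 q1 L21)
  (bq_relator i3 i1 q2 L31) (bq_relator i3 i2 q3 L32).
case=> _ [_ rel] _; rewrite -!feval_relator.
by split; apply/rel/ideal_generator.
Qed.

Lemma biquadratic_affine (A : algType K) (x : 'I_3 -> A) l m q1 q2 q3
    L21 L31 L32 L21' L31' L32' :
  (forall i, l i != 0) ->
  affine_rel l m i2 i1 q1 L21 L21' -> affine_rel l m i3 i1 q2 L31 L31' ->
  affine_rel l m i3 i2 q3 L32 L32' ->
  biquadratic x (q1, q2, q3) L21 L31 L32 ->
  biquadratic (affine l m x) (q1, q2, q3) L21' L31' L32'.
Proof.
move=> l0 r21 r31 r32 bq; have [E21 E31 E32] := biquadratic_relations bq.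
have [m21 m31 m32] := mem_seq3 (bq_relator i2 i1 q1 L21')
  (bq_relator i3 i1 q2 L31') (bq_relator i3 i2 q3 L32').
case: bq => q0 pres basis_x.
split; [exact: q0 | | exact: is_basis_affine].
apply: (presented_by_affine l0) pres; apply: forall_mem3.
- by rewrite feval_relator r21 E21 scaler0.
- by rewrite feval_relator r31 E31 scaler0.
- by rewrite feval_relator r32 E32 scaler0.
- exact: affine_rel_ideal r21 m21.
- exact: affine_rel_ideal r31 m31.
- exact: affine_rel_ideal r32 m32.
Qed.

End AffineRelations.

(** * The overlap [x3 x2 x1] *)

Section Diamond.
Context (K : fieldType) (A : algType K) (x : 'I_3 -> A).

Lemma pbw_free (s : seq (nat * nat * nat)) (c d : nat -> K) u :
  is_basis (pbw_monomial x) -> uniq s ->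
  is_lc [seq pbw_monomial x t | t <- s] c u ->
  is_lc [seq pbw_monomial x t | t <- s] d u ->
  all (fun k => c k == d k) (iota 0 (size s)).
Proof.
move=> [free _] s_uniq; rewrite /is_lc size_map => -> E.
apply/allP => k; rewrite mem_iota /= => ks; rewrite -subr_eq0; apply/eqP.
(* The coefficients are indexed by position; [index] transfers them to exponent triples, faithfully
   because [s] has no repetition. *)
pose f (t : nat * nat * nat) := c (index t s) - d (index t s).
have f0 : \sum_(t <- s) f t *: pbw_monomial x t = 0.
  rewrite (big_nth (0, 0, 0)%N) big_mkord.
  transitivity (\sum_(i < size s) ((c i *: [seq pbw_monomial x t | t <- s]`_i)
      - (d i *: [seq pbw_monomial x t | t <- s]`_i))).
    apply: eq_bigr => i _; rewrite /f index_uniq // (nth_map (0, 0, 0)%N) //.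
    by rewrite scalerBl.
  by rewrite sumrB E subrr.
have := free s f s_uniq f0 _ (mem_nth (0, 0, 0)%N ks).
by rewrite /f index_uniq.
Qed.

(* The two reductions of the overlap [x3 x2 x1] must agree. *)
Lemma overlap_coefs q1 q2 q3 c b1 beta gamma b2 lambda mu nu b3 :
  biquadratic x (q1, q2, q3) (0, 0, c, b1) (0, beta, gamma, b2)
    (lambda, mu, nu, b3) ->
  [/\ lambda = q1 * (q2 * lambda), mu * q1 = q1 * (q2 * mu),
      nu * q2 = q1 * (q2 * nu) & q3 * beta = q1 * beta] /\
  [/\ q3 * gamma = q1 * (gamma * q3), b3 = q1 * (q2 * b3 + gamma * lambda)
    & q3 * b2 + nu * beta = q1 * (gamma * mu + b2)].
Proof.
move=> bq; have [D21 D31 D32] := biquadratic_relations bq.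
case: bq => _ _ basis_x.
have E21 : x i2 * x i1 = q1 *: (x i1 * x i2) + (c *: x i3 + b1%:A).
  move/eqP: D21; rewrite /bq_defect subr_eq0 subr_eq => /eqP->.
  by rewrite !scale0r !add0r addrC.
have E31 : x i3 * x i1 = q2 *: (x i1 * x i3) +
    (beta *: x i2 + gamma *: x i3 + b2%:A).
  move/eqP: D31; rewrite /bq_defect subr_eq0 subr_eq => /eqP->.
  by rewrite !scale0r !add0r addrC.
have E32 : x i3 * x i2 = q3 *: (x i2 * x i3) +
    (lambda *: x i1 + mu *: x i2 + nu *: x i3 + b3%:A).
  move/eqP: D32; rewrite /bq_defect subr_eq0 subr_eq => /eqP->.
  by rewrite addrC.
(* The ordered monomials occurring in either reduction, listed in the same order as in [e]. *)
pose s : seq (nat * nat * nat) := [:: (1, 1, 1); (2, 0, 0); (1, 1, 0); (1, 0, 1);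
  (0, 2, 0); (0, 1, 1); (0, 0, 2); (1, 0, 0); (0, 1, 0); (0, 0, 1); (0, 0, 0)]%N.
pose e := [:: x i1 * x i2 * x i3; x i1 * x i1; x i1 * x i2; x i1 * x i3;
  x i2 * x i2; x i2 * x i3; x i3 * x i3; x i1; x i2; x i3; 1].
have Ee : [seq pbw_monomial x t | t <- s] = e.
  by rewrite /= /pbw_monomial /= !expr0 !expr1 !mulr1 !mul1r !expr2.
(* Here [x3 x2] is rewritten first; in [right_first], [x2 x1] is. *)
have left_first : x i3 * x i2 * x i1 =
    q3 *: (q2 *: (q1 *: (x i1 * x i2 * x i3) + (c *: (x i3 * x i3) + b1 *: x i3))
           + (beta *: (x i2 * x i2) + gamma *: (x i2 * x i3) + b2 *: x i2))
    + (lambda *: (x i1 * x i1) + mu *: (q1 *: (x i1 * x i2) + (c *: x i3 + b1%:A))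
       + nu *: (q2 *: (x i1 * x i3) + (beta *: x i2 + gamma *: x i3 + b2%:A))
       + b3 *: x i1).
  rewrite E32 !mulrDl -!scalerAl mul1r E21 E31 -[x i2 * x i3 * x i1]mulrA E31.
  by rewrite !mulrDr -!scalerAr mulr1 mulrA E21 !mulrDl -!scalerAl mul1r.
have right_first : x i3 * x i2 * x i1 =
    q1 *: (q2 *: (q3 *: (x i1 * x i2 * x i3) + (lambda *: (x i1 * x i1)
                   + mu *: (x i1 * x i2) + nu *: (x i1 * x i3) + b3 *: x i1))
           + (beta *: (x i2 * x i2) + gamma *: (q3 *: (x i2 * x i3) +
                (lambda *: x i1 + mu *: x i2 + nu *: x i3 + b3%:A)) + b2 *: x i2))
    + (c *: (x i3 * x i3) + b1 *: x i3).
  rewrite -mulrA E21 !mulrDr -!scalerAr mulr1 mulrA E31 !mulrDl -!scalerAl mul1r.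
  by rewrite -[x i1 * x i3 * x i2]mulrA E32 !mulrDr -!scalerAr mulr1 !mulrA.
have coefs := @pbw_free s _ _ (x i3 * x i2 * x i1) basis_x isT.
rewrite Ee in coefs.
(* The two coefficient functions are left open and filled in by [lc_rec]. *)
evar (cl : nat -> K); evar (cr : nat -> K).
assert (lcl : is_lc e cl (x i3 * x i2 * x i1)).
  rewrite left_first /cl; lc_rec.
assert (lcr : is_lc e cr (x i3 * x i2 * x i1)).
  rewrite right_first /cr; lc_rec.
have := coefs _ _ lcl lcr; rewrite /cl /cr /=.
rewrite !(mulr0, addr0, add0r, mulr1).
(* The equations kept are, in order, those at [x1^2], [x1 x2], [x1 x3], [x2^2], [x2 x3], [x1] and
   [x2]. *)
case/and5P=> _ /eqP ? /eqP ? /eqP ? /and5P[/eqP ? /eqP ? _ /eqP ? /and3P[/eqP ? _ _]].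
by [].
Qed.

End Diamond.

(** * Vanishing of the coefficients and normalization *)

Lemma normal_form_shifted (K : fieldType) (A : algType K) (x : 'I_3 -> A)
    q1 q2 q3 c b1 beta gamma b2 lambda mu nu b3 :
  q1 != 1 -> q2 != 1 -> q1 - q3 != 0 -> 1 - q1 * q2 != 0 ->
  biquadratic x (q1, q2, q3) (0, 0, c, b1) (0, beta, gamma, b2)
    (lambda, mu, nu, b3) ->
  biquadratic x (q1, q2, q3) (0, 0, c, b1) (0, 0, 0, 0) (0, 0, 0, 0).
Proof.
move=> q1n1 q2n1 h13 h12 bq; have [[q10 q20 q30] _ _] := bq.
have [[El Em En Eb] [Eg Eb3 Eb2]] := overlap_coefs bq.
have kill (k u : K) : k != 0 -> k * u = 0 -> u = 0.
  by move=> k0 /eqP; rewrite mulf_eq0 (negPf k0) => /eqP.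
have q1s : 1 - q1 != 0 by rewrite subr_eq0 eq_sym.
have q2s : 1 - q2 != 0 by rewrite subr_eq0 eq_sym.
(* Each equation is a nonzero factor times a coefficient: [1 - q1 q2] for [lambda] and [b3],
   [q1 - q3] for [beta] and [b2], [q1 (1 - q2)] for [mu], [q2 (1 - q1)] for [nu], [q3 (1 - q1)] for
   [gamma]. Those for [b3] and [b2] take this form only once [gamma] and [nu] vanish. *)
have l0 : lambda = 0 by apply: (kill _ _ h12); rewrite mulrBl {1}El; ring.
have be0 : beta = 0 by apply: (kill _ _ h13); rewrite mulrBl Eb subrr.
have mu0 : mu = 0.
  apply: (kill _ _ q10); apply: (kill _ _ q2s).
  by rewrite mulrBl mul1r [q1 * mu]mulrC {1}Em; ring.
have nu0 : nu = 0.
  apply: (kill _ _ q20); apply: (kill _ _ q1s).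
  by rewrite mulrBl mul1r [q2 * nu]mulrC {1}En; ring.
have ga0 : gamma = 0.
  apply: (kill _ _ q30); apply: (kill _ _ q1s).
  by rewrite mulrBl mul1r {1}Eg; ring.
have b30 : b3 = 0.
  move: Eb3; rewrite ga0 mul0r addr0 => Eb3.
  by apply: (kill _ _ h12); rewrite mulrBl {1}Eb3; ring.
have b20 : b2 = 0.
  move: Eb2; rewrite nu0 ga0 !mul0r addr0 add0r => Eb2.
  by apply: (kill _ _ h13); rewrite mulrBl Eb2 subrr.
by move: bq; rewrite l0 be0 mu0 nu0 ga0 b30 b20.
Qed.

Theorem theorem1p10 (K : fieldType) (A : algType K) (x : 'I_3 -> A)
    (q1 q2 q3 : K)
    (a b c b1 alpha beta gamma b2 lambda mu nu b3 : K)
    (hA : biquadratic x (q1, q2, q3)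
            (a, b, c, b1) (alpha, beta, gamma, b2) (lambda, mu, nu, b3))
    (hq1 : q1 != 1) (hq2 : q2 != 1) (hq3 : q3 != 1)
    (h13 : q1 - q3 != 0) (h12 : 1 - q1 * q2 != 0) (h23 : 1 - q2 * q3 = 0) :
  exists (y : 'I_3 -> A) (c' b1' : K),
    [/\ G3' x y,
        c' = 0 \/ c' = 1,
        b1' = 0 \/ b1' = 1
      & biquadratic y (q1, q2, q2^-1)
          (0, 0, c', b1') (0, 0, 0, 0) (0, 0, 0, 0)].
Proof.
have [[q10 q20 q30] _ _] := hA.
have <- : q3 = q2^-1.
  by apply: (mulfI q20); rewrite mulfV //; apply/esym/eqP;
     rewrite -subr_eq0 h23.
have q1s : 1 - q1 != 0 by rewrite subr_eq0 eq_sym.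
have q2s : 1 - q2 != 0 by rewrite subr_eq0 eq_sym.
(* These shifts solve the linear equations that make the coefficients [b], [a] and [alpha]
   vanish. *)
pose m (i : 'I_3) :=
  [tuple - (b / (1 - q1)); - (a / (1 - q1)); - (alpha / (1 - q2))]`_i.
have l0 (i : 'I_3) : (1 : K) != 0 by exact: oner_neq0.
have := biquadratic_affine l0 (shift_rel21 m q1 a b c b1)
  (shift_rel31 m q2 alpha beta gamma b2) (shift_rel32 m q3 lambda mu nu b3) hA.
have -> : a + (1 - q1) * m i2 = 0.
  by rewrite /m /= mulrN mulrCA mulfV // mulr1 subrr.
have -> : b + (1 - q1) * m i1 = 0.
  by rewrite /m /= mulrN mulrCA mulfV // mulr1 subrr.
have -> : alpha + (1 - q2) * m i3 = 0.
  by rewrite /m /= mulrN mulrCA mulfV // mulr1 subrr.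
move/(normal_form_shifted hq1 hq2 h13 h12).
set d := _ - _ - _ * m i1 * m i2; set z := affine _ m x => bq_z.
(* Replacing a zero parameter by 1 treats the cases [c = 0] and [d = 0], where [d] is the shifted
   constant term, together with the generic one. *)
pose unit0 (k : K) := if k == 0 then 1 else k.
have unit0_neq0 k : unit0 k != 0.
  by rewrite /unit0; case: ifP => [|->]; rewrite ?oner_neq0.
have unit0V k : (unit0 k)^-1 * k = (k != 0)%:R.
  by rewrite /unit0; case: eqVneq => [->|k0]; rewrite ?mulr0 ?mulVf.
(* Scaling requires [b1' = l2 l1 d] and [c' l3 = l2 l1 c]. With [l2 = 1], the first equation
   dictates [l1] and the second then dictates [l3]. *)
pose l (i : 'I_3) := [tuple (unit0 d)^-1; 1; unit0 c / unit0 d]`_i.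
have l_neq0 i : l i != 0.
  by case: i => [[|[|[|//]]] ?]; rewrite /l /= ?mulf_neq0 ?invr_eq0 ?oner_neq0.
exists (affine l (fun=> 0) z), (c != 0)%:R, (d != 0)%:R; split.
- by apply: G3'_affine l_neq0; apply: G3'_affine l0; apply: G3'_id.
- by case: (c != 0); [right | left].
- by case: (d != 0); [right | left].
apply: biquadratic_affine l_neq0 _ _ _ bq_z; apply: scale_rel; rewrite ?mulr0 ?mul0r //.
- by rewrite -unit0V /l /= mul1r; field; rewrite !unit0_neq0.
- by rewrite -unit0V /l /= mul1r.
Qed.
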